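(* Let $G$ be a finite simple $d$-regular Vizing-class-2 graph with resistance $r=r(G)\geq 2$ and $\mathrm{girth}(G)\geq 6r-5$. Then $\eta_p'(G)\leq 2d=2\chi'(G)-2$.
   Context: A $d$-regular graph is Vizing-class-2 if its chromatic index $\chi'(G)$ equals $d+1$. The resistance $r(G)$ of such a graph is $\min\{|c^{-1}(d+1)|: c:E(G)\to\{1,\dots,d+1\}\text{ a proper edge coloring}\}$. The girth is the length of a shortest cycle. For an edge $e$, $N'(e)$ is the set of edges other than $e$ sharing an endpoint with $e$. $\eta_p'(G)$ is the least $k$ such that there is a proper edge coloring $c:E(G)\to\{1,\dots,k\}$ with $\sum_{e\in N'(e_1)}c(e)\neq\sum_{e\in N'(e_2)}c(e)$ for every two edges $e_1,e_2$ sharing an endpoint. *)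

(* Defs.v *)
From mathcomp Require Import all_boot.

Set Implicit Arguments.
Unset Strict Implicit.
Unset Printing Implicit Defensive.

(* A finite simple graph is a symmetric irreflexive relation on a finType. *)
Section Graph.
Variables (T : finType) (e : rel T).

Definition regular (d : nat) : Prop := forall x : T, #|[set y | e x y]| = d.

Definition edges : {set {set T}} :=
  [set f : {set T} | [exists x, exists y, e x y && (f == [set x; y])]].

Definition edge_nbr (f : {set T}) : {set {set T}} :=
  [set g in edges | (g != f) && (g :&: f != set0)].

(* The colours {1, .., k} are the nonzero elements of 'I_k.+1; the values of  *)
(* a colouring outside [edges] are irrelevant.                                *)
Definition proper_edge_coloring k (c : {ffun {set T} -> 'I_k.+1}) : bool :=
  [forall f in edges, 0 < c f] &&
  [forall f in edges, forall g in edge_nbr f, c f != c g].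

Definition edge_colorable (k : nat) : bool :=
  [exists c : {ffun {set T} -> 'I_k.+1}, proper_edge_coloring c].

Definition nbr_sum k (c : {ffun {set T} -> 'I_k.+1}) (f : {set T}) : nat :=
  \sum_(g in edge_nbr f) c g.

Definition nbr_sum_colorable (k : nat) : bool :=
  [exists c : {ffun {set T} -> 'I_k.+1}, proper_edge_coloring c &&
    [forall f in edges, forall g in edge_nbr f, nbr_sum c f != nbr_sum c g]].

Lemma binary_inj n (a b : nat -> bool) :
  \sum_(i < n) a i * 2 ^ i = \sum_(i < n) b i * 2 ^ i ->
  forall i, i < n -> a i = b i.
Proof.
elim: n a b => [//|n IHn] a b.
have split_bit (h : nat -> bool) : \sum_(i < n.+1) h i * 2 ^ i =
    h 0 + (\sum_(i < n) h i.+1 * 2 ^ i).*2.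
  rewrite big_ord_recl /= expn0 muln1 -mul2n big_distrr /=; congr (_ + _).
  by apply: eq_bigr => i _; rewrite /bump /= add1n expnS mulnCA.
rewrite !split_bit => eq_ab.
have ab0 : a 0 = b 0.
  by move/(congr1 odd): eq_ab; rewrite !oddD !odd_double !addbF !oddb.
move: eq_ab; rewrite ab0 => /addnI/double_inj eq_ab [//|i] lt_in.
exact: (IHn (fun j => a j.+1) (fun j => b j.+1)).
Qed.

Lemma nbr_sum_colorable_ex : exists k, nbr_sum_colorable k.
Proof.
set N := #|{set T}|.
have lt_c (f : {set T}) : 2 ^ enum_rank f < (2 ^ N).+1.
  by rewrite ltnS leq_exp2l // ltnW.
exists (2 ^ N).
apply/existsP; exists [ffun f : {set T} => Ordinal (lt_c f)].
apply/andP; split; first (apply/andP; split).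
- by apply/forall_inP => f _; rewrite ffunE /= expn_gt0.
- apply/forall_inP => f _; apply/forall_inP => g; rewrite inE => /and3P[_ gf _].
  rewrite !ffunE -val_eqE /= eqn_exp2l //.
  by rewrite val_eqE (inj_eq enum_rank_inj) eq_sym.
- apply/forall_inP => f fE; apply/forall_inP => g gN; apply/negP => /eqP.
  pose mb (h : {set T}) (i : nat) := [exists s, (enum_rank s == i :> nat) && (s \in edge_nbr h)].
  have sumE h : nbr_sum [ffun f0 : {set T} => Ordinal (lt_c f0)] h =
      \sum_(i < N) mb h i * 2 ^ i.
    rewrite /nbr_sum (reindex (@enum_rank {set T})) /=; last first.
      exact/onW_bij/enum_rank_bij.
    rewrite big_mkcond /=; apply: eq_bigr => s _; rewrite ffunE /=.
    suff -> : mb h (enum_rank s) = (s \in edge_nbr h).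
      by case: (s \in _); rewrite ?mul1n.
    apply/existsP/idP => [[s' /andP[/eqP/val_inj/enum_rank_inj-> //]]|sh].
    by exists s; rewrite eqxx.
  rewrite !sumE => /binary_inj/(_ (enum_rank g) (ltn_ord _)).
  have -> : mb f (enum_rank g) by apply/existsP; exists g; rewrite eqxx.
  move/esym/existsP => [s /andP[/eqP/val_inj/enum_rank_inj->]].
  by rewrite inE eqxx andbF.
Qed.

Lemma edge_colorable_ex : exists k, edge_colorable k.
Proof.
have [k /existsP[c /andP[pc _]]] := nbr_sum_colorable_ex.
by exists k; apply/existsP; exists c.
Qed.

Definition chromatic_index : nat := ex_minn edge_colorable_ex.

(* eta_p' *)
Definition eta_p : nat := ex_minn nbr_sum_colorable_ex.

(* The default #|edges| bounds every colour class, so it affects the minimum  *)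
(* only when no proper colouring with d + 1 colours exists.                   *)
Definition resistance (d : nat) : nat :=
  \big[minn/#|edges|]_(c : {ffun {set T} -> 'I_d.+2} | proper_edge_coloring c)
    #|[set f in edges | c f == d.+1 :> nat]|.

Definition has_cycle (n : nat) : bool :=
  (2 < n) && [exists p : n.-tuple T, ucycleb e p].

(* A cycle has at most #|T| vertices; the value #|T|.+1 is taken exactly by   *)
(* acyclic graphs, and a regular graph of chromatic index d + 1 has a cycle.  *)
Definition girth : nat :=
  \big[minn/#|T|.+1]_(n < #|T|.+1 | has_cycle n) n.

End Graph.

(* Main.v *)
Require Import Defs.
From mathcomp Require Import all_boot zify.

(**
Take a proper colouring c with colours 1..d+1 whose class M of colour d+1 has
minimal size r, recolour every edge outside M by the odd number 2c-1, and give
the edges of M even colours in 2..2d. The two neighbourhood sums at edges xy,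
xz differ iff s(y) - 2h(xy) <> s(z) - 2h(xz), where s(y) is the sum of the
colours at y. Vertices not covered by M all have the same s, and vertices
covered by M have the other parity of s. So only edges of M at distance at
most 2 can conflict. If each edge of M conflicts with at most one other,
girth at least 7 leaves at most two linear constraints per conflicting pair;
three even colours satisfy them, and for d = 2 the two constraints coincide.

To make conflicts rare, an edge of M is moved along an alternating path: with
p0 p1 uncoloured and j missing at p0, the minimality of r provides an edge
p1 p2 of colour j, and the colour j can be moved from p1 p2 to p0 p1. The
resulting walk never backtracks, so its first 4r-3 edges form a path. An edge
of M that stays put conflicts with at most 6 of them and meets at most 2 of
them, hence for r >= 3 some position meets no other edge of M and conflicts
with at most one; for r = 2 nothing has to be moved.
*)

Set Implicit Arguments.
Unset Strict Implicit.
Unset Printing Implicit Defensive.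

(** * Auxiliary facts: two-element sets, minima, counting, choices and small linear constraints *)

Lemma eq_set2 (T : finType) (a b x y : T) :
  ([set a; b] == [set x; y]) = (a == x) && (b == y) || (a == y) && (b == x).
Proof.
apply/eqP/orP => [abxy|[]/andP[/eqP-> /eqP->] //]; last by rewrite setUC.
have := set21 a b; have := set22 a b; have := set21 x y; have := set22 x y.
rewrite -{1 2}abxy {3 4}abxy !in_set2.
do 4!(case/orP=> /eqP ?; subst); rewrite ?eqxx ?orbT ?andbT; by [left|right].
Qed.

Section BigMinn.
Variables (I : finType) (P : pred I) (F : I -> nat) (x0 : nat).

Lemma bigminn_leq i : P i -> \big[minn/x0]_(j | P j) F j <= F i.
Proof.
move=> Pi; have: i \in index_enum I by rewrite mem_index_enum.
elim: (index_enum I) => // j r IHr; rewrite in_cons big_cons.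
case/orP=> [/eqP<-|/IHr le_i]; first by rewrite Pi geq_minl.
by case: ifP => // _; rewrite geq_min le_i orbT.
Qed.

Lemma bigminn_attained i : P i -> F i <= x0 ->
  exists2 j, P j & \big[minn/x0]_(j | P j) F j = F j.
Proof.
move=> Pi Fi; have: \big[minn/x0]_(j | P j) F j = x0 \/
    exists2 j, P j & \big[minn/x0]_(j | P j) F j = F j.
  elim/big_rec: _ => [|j x Pj]; first by left.
  rewrite /minn; case: ifP => _; first by right; exists j.
  by case=> [->|]; [left|right].
case=> // min_x0; exists i => //; apply/eqP.
by rewrite eqn_leq bigminn_leq // min_x0 Fi.
Qed.

End BigMinn.

Lemma sum_bool_leq_size n (P : nat -> bool) (s : seq nat) :
  (forall t, t < n -> P t -> t \in s) -> \sum_(t < n) P t <= size s.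
Proof.
move=> Ps; have -> : \sum_(t < n) P t = size [seq t <- iota 0 n | P t].
  rewrite -(big_mkord predT (fun t => nat_of_bool (P t))) size_filter
    -sum1_count.
  rewrite [RHS]big_mkcond /index_iota subn0.
  by apply: eq_bigr => t _; case: (P t).
apply: uniq_leq_size; first by rewrite filter_uniq ?iota_uniq.
by move=> t; rewrite mem_filter mem_iota add0n => /andP[Pt tn]; apply: Ps.
Qed.

(** On [M] the relation [R] has degree at most one, so values can be fixed one element at a time:
    when [i] is added to a solved [M :\ i], at most one earlier value constrains it. An element
    without a partner gets [x0]. *)
Lemma matching_choice (I : finType) (M : {set I}) (R : rel I) (A : pred nat)
    (P : I -> I -> nat -> nat -> Prop) :
  symmetric R -> (exists x, A x) ->
  {in M, forall i, \sum_(j in M :\ i) R i j <= 1} ->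
  (forall i j x y, P i j x y -> P j i y x) ->
  (forall i j y, i \in M -> j \in M -> i != j -> A y ->
    exists2 x, A x & P i j x y) ->
  exists X, {in M, forall i, A (X i)} /\
    (forall i j, i \in M -> j \in M -> i != j -> R i j -> P i j (X i) (X j)).
Proof.
move=> Rsym [x0 Ax0]; move: {2}#|M| (erefl #|M|) => n.
elim: n M => [|n IHn] M cardM R1 Psym exP.
  move/cards0_eq: cardM => ->.
  by exists (fun=> x0); split=> [i|i j]; rewrite in_set0.
have [i iM] : exists i, i \in M by apply/card_gt0P; rewrite cardM.
have subM j : j \in M :\ i -> j \in M by case/setD1P.
have [||||X [AX PX]] := IHn (M :\ i) => //.
- by move: cardM; rewrite (cardsD1 i) iM => -[].
- move=> j jM; apply: leq_trans (R1 j (subM j jM));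
    rewrite big_mkcond [leqRHS]big_mkcond.
  apply: leq_sum => k _; rewrite !in_setD1.
  by case: (k != j) (k != i) (k \in M) => [] [] [].
- by move=> j k y jM kM; apply: exP; exact: subM.
have [x Ax Px] : exists2 x, A x & {in M :\ i, forall j, R i j -> P i j x (X j)}.
  have [/exists_inP[j jM Rij]|noR] := boolP [exists j in M :\ i, R i j];
    last first.
    by exists x0 => // j jM Rij; case/exists_inP: noR; exists j.
  have [x Ax Pij] : exists2 x, A x & P i j x (X j).
    by apply: exP => //; [exact: subM | case/setD1P: jM;
      rewrite eq_sym | exact: AX].
  exists x => // k kM Rik; suff -> : k = j by [].
  apply/eqP; apply: contraTT (R1 i iM) => kj.
  rewrite -ltnNge (bigD1 j) //= Rij (bigD1 k) /= ?Rik ?addnA ?leq_addr //.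
  by rewrite kM.
have memD j : j \in M -> j != i -> j \in M :\ i by rewrite !inE => -> ->.
exists (fun j => if j == i then x else X j); split=> [j jM|j k jM kM jk Rjk].
  by case: eqVneq => // ji; apply: AX; exact: memD.
case: eqVneq => [ji|ji]; case: eqVneq => [ki|ki].
- by rewrite ji ki eqxx in jk.
- by rewrite ji; apply: Px; [exact: memD | rewrite -ji].
- by rewrite ki; apply/Psym/Px; [exact: memD | rewrite Rsym -ki].
- by apply: PX => //; exact: memD.
Qed.

Lemma avoid_one a b : exists2 n, 0 < n <= 2 & a + n.*2 != b.
Proof.
have: (a + 1.*2 != b) || (a + 2.*2 != b) by lia.
by case/orP; [exists 1 | exists 2].
Qed.

(** Each of the two equations excludes at most one [n], so three candidates suffice when [d > 2].
    For [d = 2] only two are available, but then [a + b = a' + b'] makes both equations exclude the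
    same [n]. *)
Lemma avoid_two d a b a' b' k y : 1 < d -> (d = 2 -> a + b = a' + b') ->
  exists2 n, 0 < n <= d & (b + n.*2 + 2 * k != a' + y + 2 * n.*2) &&
                          (a + n.*2 + 2 * y != b' + y + 2 * k).
Proof.
move=> d1 d2; pose ok n := (b + n.*2 + 2 * k != a' + y + 2 * n.*2) &&
                           (a + n.*2 + 2 * y != b' + y + 2 * k).
have [d_le2|d_gt2] := leqP d 2.
  have {}d2 : a + b = a' + b' by apply: d2; lia.
  have: ok 1 || ok 2 by rewrite /ok; lia.
  by case/orP; [exists 1 | exists 2]; rewrite // (ltnW d1).
have: [|| ok 1, ok 2 | ok 3] by rewrite /ok; lia.
by case/or3P; [exists 1 | exists 2 | exists 3]; rewrite // ?d1 ?(ltnW d1).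
Qed.

(** * Edges, colourings and neighbourhood sums *)

Section Basics.
Variables (T : finType) (e : rel T).
Hypotheses (e_sym : symmetric e) (e_irr : irreflexive e).

Lemma edge_neq x y : e x y -> x != y.
Proof. by apply: contraTneq => ->; rewrite e_irr. Qed.

Lemma edgesP f :
  reflect (exists x y, e x y /\ f = [set x; y]) (f \in edges e).
Proof.
rewrite inE; apply: (iffP existsP) => [[x /existsP[y /andP[exy /eqP->]]]|].
  by exists x, y.
by case=> x [y [exy ->]]; exists x; apply/existsP; exists y; rewrite exy eqxx.
Qed.

Lemma mem_edges x y : ([set x; y] \in edges e) = e x y.
Proof.
apply/edgesP/idP => [[a [b [eab /eqP]]]|exy]; last by exists x, y.
by rewrite eq_set2 => /orP[]/andP[/eqP-> /eqP->] //; rewrite e_sym.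
Qed.

Lemma edge_mem f x : f \in edges e -> x \in f ->
  exists2 y, e x y & f = [set x; y].
Proof.
case/edgesP=> a [b [eab ->]]; rewrite in_set2 => /orP[]/eqP->;
  first by exists b.
by exists a; [rewrite e_sym | rewrite setUC].
Qed.

Lemma edge_nbrP f g : f \in edges e -> g \in edge_nbr e f ->
  exists x y z, [/\ e x y, e x z, y != z, f = [set x; y] & g = [set x; z]].
Proof.
move=> fE; rewrite inE => /and3P[gE gf /set0Pn[x /setIP[xg xf]]].
have [y exy fxy] := edge_mem fE xf; have [z exz gxz] := edge_mem gE xg.
exists x, y, z; split=> //; apply: contraNneq gf => yz.
by rewrite gxz fxy yz.
Qed.

Lemma mem_edge_nbr x y z : e x y -> e x z -> y != z ->
  [set x; z] \in edge_nbr e [set x; y].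
Proof.
move=> exy exz yz; rewrite inE mem_edges exz eq_set2 eqxx /= eq_sym (negPf yz).
rewrite /= negb_and (negPf (edge_neq exy)) /=.
by apply/set0Pn; exists x; rewrite in_setI !set21.
Qed.

Definition proper_coloring (c : {set T} -> nat) :=
  forall x y z, e x y -> e x z -> y != z -> c [set x; y] != c [set x; z].

Definition in_range k (c : {set T} -> nat) :=
  forall f, f \in edges e -> 0 < c f <= k.

Lemma proper_edge_coloring_proper k (c : {ffun {set T} -> 'I_k.+1}) :
  proper_edge_coloring e c -> in_range k (fun f => c f) /\ proper_coloring (fun
    f => c f).
Proof.
case/andP=> /forall_inP c_gt0 /forall_inP c_nbr;
  split=> [f fE|x y z exy exz yz].
  by rewrite c_gt0 //= -ltnS.
have /forall_inP := c_nbr [set x; y] (etrans (mem_edges x y) exy).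
by move/(_ _ (mem_edge_nbr exy exz yz)); rewrite val_eqE.
Qed.

Definition color_ffun k (c : {set T} -> nat) : {ffun {set T} -> 'I_k.+1} :=
  [ffun f => inord (c f)].

Lemma color_ffunE k c f : in_range k c -> f \in edges e ->
  color_ffun k c f = c f :> nat.
Proof. by move=> ck fE; rewrite ffunE inordK // ltnS; case/andP: (ck f fE). Qed.

Lemma proper_color_ffun k c : in_range k c -> proper_coloring c ->
  proper_edge_coloring e (color_ffun k c).
Proof.
move=> ck pc; apply/andP; split; apply/forall_inP => f fE.
  by rewrite color_ffunE //; case/andP: (ck f fE).
apply/forall_inP => g gf; have gE : g \in edges e by move: gf;
  rewrite inE => /andP[].
have [x [y [z [exy exz yz fxy gxz]]]] := edge_nbrP fE gf.
by rewrite -val_eqE /= !color_ffunE // fxy gxz pc.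
Qed.

Definition vertex_sum (c : {set T} -> nat) x := \sum_(y | e x y) c [set x; y].

(** The edge [xy] lies in the stars of both its ends, and in a simple graph no other edge does. *)
Lemma nbr_sumE k (c : {ffun {set T} -> 'I_k.+1}) x y : e x y ->
  nbr_sum e c [set x; y] + 2 * c [set x; y] =
  vertex_sum (fun f => c f) x + vertex_sum (fun f => c f) y.
Proof.
move=> exy; pose star z := [set [set z; w] | w in [set w | e z w]].
have sumE z : vertex_sum (fun f => c f) z = \sum_(f in star z) c f.
  rewrite /star big_imset /=; first by apply: eq_bigl => w; rewrite inE.
  move=> w w' _ _ /eqP; rewrite eq_set2 eqxx /= => /orP[/eqP//|].
  by case/andP=> /eqP-> /eqP.
have starP z f : (f \in star z) = (f \in edges e) && (z \in f).
  apply/imsetP/andP=> [[w]|[fE zf]].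
    by rewrite inE => ezw ->; rewrite mem_edges set21.
  by have [w ezw ->] := edge_mem fE zf; exists w; rewrite ?inE.
have sumD z : z \in [set x; y] -> vertex_sum (fun f => c f) z =
    c [set x; y] + \sum_(f in star z | f != [set x; y]) c f.
  move=> zxy; rewrite sumE (bigD1 [set x; y]) //=.
  by rewrite starP mem_edges exy.
rewrite !sumD ?set21 ?set22 // addnACA addnn -mul2n addnC; congr (_ + _).
have nbrE f : (f \in edge_nbr e [set x; y]) =
    [&& f \in edges e, f != [set x; y] & (x \in f) || (y \in f)].
  rewrite inE; do 2!congr (_ && _).
  apply/set0Pn/orP=> [[z /setIP[zf]]|[]zf].
  - by rewrite in_set2 => /orP[]/eqP<-; [left|right].
  - by exists x; rewrite in_setI zf set21.
  - by exists y; rewrite in_setI zf set22.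
rewrite /nbr_sum (bigID (fun f : {set T} => x \in f)) /=; congr (_ + _).
  apply: eq_bigl => f; rewrite nbrE starP.
  by case: (x \in f); rewrite ?andbT ?andbF.
apply: eq_bigl => f; rewrite nbrE starP.
case: (boolP (f \in edges e)) => //= fE; case: eqP => //= fxy;
  rewrite ?andbF //.
case: (boolP (x \in f)) => xf; rewrite ?andbT //= ?andbF.
apply/esym/negbTE/negP => yf; apply: fxy.
have [z exz fxz] := edge_mem fE xf; move: yf; rewrite fxz in_set2.
by rewrite eq_sym (negPf (edge_neq exy)) => /eqP->.
Qed.

(** By [nbr_sumE] both sums contain the vertex sum of the common endpoint [x]; cancelling it leaves
    a condition on [y] and [z] alone. *)
Lemma proper_nbr_sum_colorable k c : in_range k c -> proper_coloring c ->
  (forall x y z, e x y -> e x z -> y != z ->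
    vertex_sum c y + 2 * c [set x; z] != vertex_sum c z + 2 * c [set x; y]) ->
  nbr_sum_colorable e k.
Proof.
move=> ck pc csum; apply/existsP; exists (color_ffun k c).
rewrite proper_color_ffun //=; apply/forall_inP => f fE;
  apply/forall_inP => g gf.
have [x [y [z [exy exz yz fxy gxz]]]] := edge_nbrP fE gf.
have vsE w : vertex_sum (fun f => color_ffun k c f) w = vertex_sum c w.
  by apply: eq_bigr => u ewu; rewrite color_ffunE ?mem_edges.
have := nbr_sumE (color_ffun k c) exy; have := nbr_sumE (color_ffun k c) exz.
rewrite !vsE !color_ffunE ?mem_edges // -fxy -gxz.
have := csum _ _ _ exy exz yz; rewrite -fxy -gxz; lia.
Qed.

(** * Girth bounds from closed walks and pairs of walks *)

Lemma ucycle_girth p : 2 < size p -> ucycle e p -> girth e <= size p.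
Proof.
move=> p_gt2 /andP[cp up]; have p_le : size p < #|T|.+1.
  by rewrite ltnS -(card_uniqP up) max_card.
have cyc : has_cycle e (Ordinal p_le).
  rewrite /has_cycle p_gt2; apply/existsP; exists (in_tuple p).
  by rewrite /ucycleb cp.
exact: (bigminn_leq (fun n : 'I_#|T|.+1 => n : nat) _ cyc).
Qed.

Definition walk m (p : nat -> T) := forall t, t < m -> e (p t) (p t.+1).

Definition nonbacktracking m (p : nat -> T) :=
  forall t, t.+1 < m -> p t != p t.+2.

(** If [p 0, .., p (m - 1)] are distinct, the walk is a cycle; otherwise a repeated vertex cuts out
    a shorter closed walk. Nothing is required at the vertex where the walk closes, so subwalks
    inherit the hypotheses. *)
Lemma closed_walk_girth m p : 0 < m -> walk m p -> nonbacktracking m p ->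
  p 0 = p m -> girth e <= m.
Proof.
elim/ltn_ind: m p => m IHm p m_gt0 wp bp p0m.
have [up|] := boolP (uniq (mkseq p m)).
  have m_gt2 : 2 < m.
    move: m m_gt0 wp bp p0m {IHm up} => [|[|[|//]]] // _ wp bp p0m.
      by have := wp 0 isT; rewrite -p0m e_irr.
    by have := bp 0 isT; rewrite p0m eqxx.
  have := @ucycle_girth (mkseq p m); rewrite size_mkseq; apply=> //.
  case: m m_gt0 wp p0m {IHm bp m_gt2} up => // m _ wp p0m up.
  rewrite /ucycle up andbT /mkseq /= (iotaDl 1 0) -map_comp.
  rewrite -/(mkseq (p \o S) m) p0m -[p m.+1]/((p \o S) m) -mkseqS.
  apply/(pathP (p 0)) => -[|i]; rewrite size_mkseq => im;
    rewrite [X in e X _]/=.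
    by rewrite -p0m wp.
  by rewrite -/(mkseq (p \o S) m.+1) !nth_mkseq /= ?wp // ltnW.
case/(uniqPn (p 0)) => i [j [ij]]; rewrite size_mkseq => jm.
rewrite !nth_mkseq // => [pij|]; last exact: ltn_trans jm.
have: girth e <= j - i; last by lia.
apply: (IHm (j - i) _ (fun t => p (i + t))); try lia.
- by move=> t lt_t; rewrite addnS wp //; lia.
- by move=> t lt_t; rewrite !addnS bp //; lia.
- by rewrite addn0 subnKC // ltnW.
Qed.

(* Compare the last steps of p and q: if they agree, drop both; otherwise
   appending the reversed last step of q to p keeps it nonbacktracking. *)
Lemma two_walks_girth m k p q : k <= m -> walk m p -> nonbacktracking m p ->
  walk k q -> q 0 = p 0 -> q k = p m ->
  girth e <= m + k \/ k = m /\ (forall i, i <= k -> q i = p i).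
Proof.
elim: k m p => [|k IHk] m p km wp bp wq q0 qk.
  case: m km wp bp qk => [|m] _ wp bp qk.
    by right; split=> // i; rewrite leqn0 => /eqP->.
  by left; rewrite addn0; apply: (@closed_walk_girth _ p) => //; rewrite -q0.
have wq' : walk k q by move=> t tk; apply: wq; lia.
case: m km wp bp qk => // m km wp bp qk.
have [qpm|qpm] := eqVneq (q k) (p m).
  have [|||gm|[km' eq_qp]] := IHk m p _ _ _ wq' q0 qpm; try lia.
  - by move=> t tm; apply: wp; lia.
  - by move=> t tm; apply: bp; lia.
  - right; split=> [|i ik]; first by rewrite km'.
    have [->|ik'] := eqVneq i k.+1; first by rewrite qk km'.
    by apply: eq_qp; lia.
pose p' t := if t <= m.+1 then p t else q k.
have [||||gm|[? _]] := IHk m.+2 p' _ _ _ wq' q0; try lia.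
- move=> t tm; rewrite /p'; case: ifP => [_|]; last lia.
  have [tm1|tm1] := leqP t.+1 m.+1; first by rewrite wp.
  have -> : t = m.+1 by lia.
  by rewrite -qk e_sym wq.
- move=> t tm; rewrite /p'; case: ifP => [_|]; last lia.
  have [tm1|tm1] := leqP t.+2 m.+1; first by rewrite bp.
  have -> : t = m by lia.
  by rewrite eq_sym.
- by rewrite /p' ltnn.
Qed.
End Basics.

(** * Conflicts between edges, and their number along a nonbacktracking walk *)

Section Conflicts.
Variables (T : finType) (e : rel T).
Hypotheses (e_sym : symmetric e) (e_irr : irreflexive e).

(* Distance at most 2 from an edge f: w may itself be an endpoint of f. *)
Definition near x (f : {set T}) := [exists w, exists y in f, e w x && e w y].

Definition conflict (f g : {set T}) := [exists x in f, near x g].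

Lemma nearP x (f : {set T}) : reflect (exists w y, [/\ y \in f, e w x & e w y])
  (near x f).
Proof.
apply: (iffP existsP) => [[w /exists_inP[y yf /andP[]]]|[w [y [yf wx wy]]]].
  by exists w, y.
by exists w; apply/exists_inP; exists y; rewrite ?wx.
Qed.

Lemma conflictP (f g : {set T}) : reflect
  (exists w x y, [/\ x \in f, y \in g, e w x & e w y]) (conflict f g).
Proof.
apply: (iffP exists_inP) => [[x xf /nearP[w [y [yg wx wy]]]]|].
  by exists w, x, y.
by case=> w [x [y [xf yg wx wy]]]; exists x => //; apply/nearP; exists w, y.
Qed.

Lemma conflict_sym : symmetric conflict.
Proof.
by move=> f g; apply/conflictP/conflictP=> -[w [x [y []]]]; exists w, y, x.
Qed.

Section NearWalk.
Variables (n : nat) (p : nat -> T) (f : {set T}).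
Hypotheses (wp : walk e n p) (bp : nonbacktracking n p) (fE : f \in edges e).
Hypotheses (pf : forall t, t < n -> [set p t; p t.+1] != f).

(** A detour through [f] joins [p i] to [p j] in 4 steps, or in 5 if [f] itself is crossed. If this
    is compared with a longer stretch of the walk, [two_walks_girth] bounds the girth, unless the
    detour is the walk itself. *)
Lemma near_dist i j : i < j -> j <= n -> near (p i) f -> near (p j) f ->
  j - i <= 4 \/ girth e <= j - i + 5.
Proof.
move=> ij jn /nearP[w [x [xf wi wx]]] /nearP[w' [y [yf wj wy]]].
have [//|ij4] := leqP (j - i) 4; first by left.
pose pi t := p (i + t).
have wpi : walk e (j - i) pi by move=> t lt_t; rewrite /pi addnS wp //; lia.
have bpi : nonbacktracking (j - i) pi.
  by move=> t lt_t; rewrite /pi !addnS bp //; lia.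
right; have [xy|xy] := eqVneq x y.
  have [||||gi|[]] := two_walks_girth (k := 4) e_sym e_irr _ wpi bpi
    (q := nth (p i) [:: p i; w; x; w'; p j]); rewrite /pi ?addn0 //=; try lia.
  - by move=> [|[|[|[|]]]] //= _; rewrite ?xy // e_sym // -xy.
  - by rewrite subnKC // ltnW.
have [z exz fxz] := edge_mem e_sym fE xf.
have yz : y = z by move: yf; rewrite fxz in_set2 eq_sym (negPf xy) => /eqP.
have [||||//|[]] := two_walks_girth (k := 5) e_sym e_irr _ wpi bpi
  (q := nth (p i) [:: p i; w; x; y; w'; p j]); rewrite /pi ?addn0 //=.
- by move=> [|[|[|[|[|]]]]] //= _; rewrite ?yz // e_sym // -yz.
- by rewrite subnKC // ltnW.
(* If the detour coincides with the walk, step [i + 2] of the walk traverses [f], which [pf]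
   forbids. *)
move=> ji q_p; have := pf (t := i + 2).
rewrite -addnS -(q_p 2) // -(q_p 3) //= fxz yz eqxx; lia.
Qed.

Lemma conflict_near t : t < n -> conflict [set p t; p t.+1] f ->
  exists2 k, (k <= n) && near (p k) f & (k == t) || (k == t.+1).
Proof.
move=> tn /exists_inP[x]; rewrite in_set2 => /orP[]/eqP-> xf.
  by exists t; rewrite ?eqxx // ltnW.
by exists t.+1; rewrite ?eqxx ?orbT // tn.
Qed.

Lemma conflict_count : 9 <= n -> n + 4 <= girth e ->
  \sum_(t < n) conflict [set p t; p t.+1] f <= 6.
Proof.
move=> n9 gn; pose P k := (k <= n) && near (p k) f.
have [exP|/existsPn noP] := boolP [exists k : 'I_n.+1, P k]; last first.
  rewrite big1 // => t _; apply/eqP; rewrite eqb0; apply/negP.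
  case/(conflict_near (ltn_ord t)) => k Pk _.
  have kn : k < n.+1 by case/andP: Pk.
  by have := noP (Ordinal kn); rewrite /P /= Pk.
have exP' : exists k, P k by case/existsP: exP => k; exists k.
have leP k : P k -> k <= n by case/andP.
have [i Pi min_i] := ex_minnP exP'; have [j Pj max_j] := ex_maxnP exP' leP.
have Pdist k l : P k -> P l -> k <= l -> l - k <= 4 \/ n <= (l - k).+1.
  case/andP=> kn nk /andP[ln nl]; rewrite leq_eqVlt => /orP[/eqP->|kl].
    by left; rewrite subnn.
  by case: (near_dist kl ln nk nl) => [|?]; [left|right; lia].
have := leP _ Pj; have := min_i _ Pj => ij jn.
(* The near indices span at most 4 steps, or lie within one step of the two
   ends of the walk, except for one possible middle index when n = 9. *)
have [ij4|ij4] := leqP (j - i) 4.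
  (* Vertices with indices [i] to [i + 4] lie only on the six walk edges numbered [i - 1] to
     [i + 4]. *)
  apply: (@sum_bool_leq_size _ (fun t => conflict [set p t; p t.+1] f)
            (iota i.-1 6)) => t tn.
  case/(conflict_near tn) => k Pk kt; rewrite mem_iota.
  have := min_i _ Pk; have := max_j _ Pk; lia.
apply: (@sum_bool_leq_size _ (fun t => conflict [set p t; p t.+1] f)
          [:: 0; 1; n.-2; n.-1; i + 3; i + 4]) => t tn.
case/(conflict_near tn) => k Pk kt; rewrite !inE.
have := min_i _ Pk; have := max_j _ Pk; have := leP _ Pk => kn kj ik.
have := Pdist _ _ Pi Pk ik; have := Pdist _ _ Pk Pj kj.
have := Pdist _ _ Pi Pj ij; lia.
Qed.

(** The walk visits [f] at most once: two visits at the same vertex close a walk of length at most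
    [n], and visits at both ends one of length at most [n + 1]. A single visited vertex lies on at
    most two consecutive walk edges. *)
Lemma overlap_count : n + 2 <= girth e ->
  \sum_(t < n) ([set p t; p t.+1] :&: f != set0) <= 2.
Proof.
move=> gn.
have uniq_pf i j : i < j -> j <= n -> p i \in f -> p j \in f -> False.
  move=> ij jn pif pjf; pose pi t := p (i + t).
  have wpi : walk e (j - i) pi by move=> t lt_t; rewrite /pi addnS wp //; lia.
  have bpi : nonbacktracking (j - i) pi.
    by move=> t lt_t; rewrite /pi !addnS bp //; lia.
  have [z eiz fiz] := edge_mem e_sym fE pif.
  have pij : pi (j - i) = p j by rewrite /pi subnKC // ltnW.
  have [pjz|pjz] := eqVneq (p j) z; last first.
    have pji : p j = p i.
      by move: pjf; rewrite fiz in_set2 (negPf pjz) orbF => /eqP.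
    have := closed_walk_girth e_irr _ wpi bpi; rewrite pij pji /pi addn0.
    move/(_ _ erefl); lia.
  have [||||gi|[]] := two_walks_girth (k := 1) e_sym e_irr _ wpi bpi
    (q := nth (p i) [:: p i; p j]); rewrite /pi ?addn0 //=; try lia.
  - by move=> [|] //= _; rewrite pjz.
  - move=> ji _; have := pf (t := i); have -> : i.+1 = j by lia.
    rewrite fiz pjz eqxx; lia.
pose P k := (k <= n) && (p k \in f).
have overlapP t : t < n -> [set p t; p t.+1] :&: f != set0 ->
    exists2 k, P k & (k == t) || (k == t.+1).
  move=> tn /set0Pn[x /setIP[]]; rewrite in_set2 /P => /orP[]/eqP-> xf.
    by exists t; rewrite ?eqxx ?xf // ltnW.
  by exists t.+1; rewrite ?eqxx ?orbT ?xf // tn.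
have [exP|/existsPn noP] := boolP [exists k : 'I_n.+1, P k]; last first.
  rewrite big1 // => t _; apply/eqP; rewrite eqb0; apply/negP.
  case/(overlapP _ (ltn_ord t)) => k Pk _.
  have kn : k < n.+1 by case/andP: Pk.
  by have := noP (Ordinal kn); rewrite /= Pk.
case/existsP: exP => i /andP[le_in pif].
apply: (@sum_bool_leq_size _ (fun t => [set p t; p t.+1] :&: f != set0)
          [:: i.-1; nat_of_ord i]) => t tn.
case/(overlapP _ tn) => k /andP[kn pkf] kt; rewrite !inE.
have [ki|ki|ki] := ltngtP k i; last lia.
  by case: (uniq_pf _ _ ki le_in pkf pif).
by case: (uniq_pf _ _ ki kn pif pkf).
Qed.

End NearWalk.

(** Averaging: each edge of [M] contributes at most 6 conflicts and 2 overlaps, so the total weight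
    is at most [8 * #|M| < 2 * n] and some position has weight at most 1. *)
Lemma free_position n p (M : {set {set T}}) :
  walk e n p -> nonbacktracking n p -> 9 <= n -> n + 4 <= girth e ->
  {in M, forall f, f \in edges e} -> 4 * #|M| < n ->
  (forall t, t < n -> [set p t; p t.+1] \notin M) ->
  exists2 t, t < n & {in M, forall f : {set T}, [disjoint [set p t;
    p t.+1] & f]} /\
    \sum_(f in M) conflict [set p t; p t.+1] f <= 1.
Proof.
move=> wp bp n9 gn ME Mn pM.
pose ov t (f : {set T}) := [set p t; p t.+1] :&: f != set0.
pose W t := \sum_(f in M) (conflict [set p t; p t.+1] f + ov t f).
have sumW : \sum_(t < n) W t <= 8 * #|M|.
  rewrite /W exchange_big /= mulnC -sum_nat_const leq_sum // => f fM.
  have pf t : t < n -> [set p t; p t.+1] != f.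
    by move=> tn; apply: contraNneq (pM t tn) => ->.
  rewrite big_split /= -[8]/(6 + 2) leq_add //.
    exact: (conflict_count wp bp (ME f fM) pf).
  by apply: (overlap_count wp bp (ME f fM) pf); lia.
have [/existsP[t Wt]|/existsPn noW] := boolP [exists t : 'I_n, W t <= 1];
  last first.
  have: \sum_(t < n) 2 <= \sum_(t < n) W t.
    by apply: leq_sum => t _; rewrite ltnNge noW.
  rewrite sum_nat_const card_ord; lia.
exists t => //; split; last first.
  by apply: leq_trans Wt; apply: leq_sum => f _; rewrite leq_addr.
(* An edge that meets [f] also conflicts with it, so an overlap alone already costs weight 2. *)
move=> f fM; rewrite -setI_eq0; apply: contraLR Wt => ovf.
rewrite -ltnNge /W (bigD1 f) //= /ov ovf.
suff -> : conflict [set p t; p t.+1] f by rewrite ltn_addr.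
have /set0Pn[x /setIP[xp xf]] := ovf.
have [y exy _] := edge_mem e_sym (ME f fM) xf.
by apply/conflictP; exists y, x, x; rewrite e_sym exy.
Qed.

End Conflicts.

(** * Moving an uncoloured edge along an alternating path *)

Section Shifting.
Variables (T : finType) (e : rel T).
Hypotheses (e_sym : symmetric e) (e_irr : irreflexive e).

Definition color_class (c : {set T} -> nat) k := [set f in edges e | c f == k].

Definition misses (c : {set T} -> nat) x k := forall y, e x y -> c [set x;
  y] != k.

Definition matching (M : {set {set T}}) := forall x y z,
  e x y -> e x z -> y != z -> [set x; y] \in M -> [set x; z] \in M -> False.

Variable d : nat.
Hypothesis e_reg : regular e d.

(** Pigeonhole: [f] has colour [d.+1], and the other [d - 1] edges at [x] cannot carry all of the
    colours from 1 to [d]. *)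
Lemma color_missed c f x : in_range e d.+1 c -> f \in color_class c d.+1 ->
  x \in f -> exists2 k, 0 < k <= d & misses c x k.
Proof.
move=> cd; rewrite inE => /andP[fE /eqP cf] xf.
have [y exy fxy] := edge_mem e_sym fE xf; pose N := [set z | e x z] :\ y.
pose s := [seq c [set x; z] | z <- enum N].
have [all_s|/allPn[k]] := boolP (all (mem s) (iota 1 d)).
  have: size (iota 1 d) <= size s.
    by apply: uniq_leq_size; [exact: iota_uniq | exact/allP].
  rewrite size_iota size_map -cardE /N; have := e_reg x.
  by rewrite (cardsD1 y) inE exy; lia.
rewrite mem_iota add1n ltnS => k_le kNs; exists k => // z exz.
have [->|zy] := eqVneq z y; first by rewrite -fxy cf; lia.
apply: contraNneq kNs => <-; rewrite inE map_f // mem_enum.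
by rewrite !inE zy exz.
Qed.

Section Shift.
Variables (M0 : {set {set T}}).
Hypotheses (M0E : {in M0, forall f, f \in edges e}) (M0m : matching M0).
Hypothesis M0_small : forall c, in_range e d.+1 c -> proper_coloring e c ->
  #|M0| < #|color_class c d.+1|.

(* Colour d.+1 means uncoloured: the uncoloured edges are those of M0 and the
   moving edge, from st_tail to st_head; these endpoints miss st_tail_col and
   st_head_col. While moving, this edge may meet M0. *)
Record state := State
  { st_col : {set T} -> nat; st_tail : T; st_head : T; st_tail_col : nat;
    st_head_col : nat }.

(** The new tail [b] still misses [k], and the new head [w] has just lost [j]. The default [b] in
    [odflt] never occurs for a shiftable state, by [head_not_misses]. *)
Definition shift s :=
  let: State c a b j k := s in
  let w := odflt b [pick w | e b w && (c [set b; w] == j)] in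
  State (fun f => if f == [set b; w] then d.+1
                  else if f == [set a; b] then j else c f) b w k j.

(** Properness is asked only of coloured edges, because the moving edge may touch [M0]. The
    condition [j != k] ensures that [b] still misses [k] after [ab] receives [j]. *)
Definition shiftable s := let: State c a b j k := s in
  [/\ [/\ e a b, in_range e d.+1 c & [set a; b] \notin M0],
      forall f, f \in edges e -> (c f == d.+1) = (f == [set a;
        b]) || (f \in M0),
      forall x y z, e x y -> e x z -> y != z ->
        c [set x; y] = c [set x; z] -> c [set x; y] = d.+1,
      [/\ 0 < j <= d, 0 < k <= d & j != k]
    & misses c a j /\ misses c b k].

(** If both ends missed [j], giving [j] to [ab] would produce a proper colouring whose top class is
    exactly [M0], against [M0_small]. *)
Lemma head_not_misses c a b j :
  e a b -> in_range e d.+1 c -> [set a; b] \notin M0 ->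
  (forall f, f \in edges e -> (c f == d.+1) = (f == [set a;
    b]) || (f \in M0)) ->
  (forall x y z, e x y -> e x z -> y != z ->
        c [set x; y] = c [set x; z] -> c [set x; y] = d.+1) ->
  0 < j <= d -> misses c a j -> misses c b j -> False.
Proof.
move=> eab cd abM0 ctop cprop jd aj bj.
pose c' f := if f == [set a; b] then j else c f.
have c'd : in_range e d.+1 c'.
  by move=> f fE; rewrite /c'; case: ifP => _; [lia | exact: cd].
have abj x y : [set x; y] == [set a; b] -> misses c x j.
  by rewrite eq_set2 => /orP[]/andP[/eqP-> _].
have ab_eq x y z : [set x; y] == [set a; b] -> [set x; z] == [set a;
  b] -> y = z.
  move=> /eqP<-; rewrite eq_set2 eqxx /= => /orP[/eqP//|/andP[/eqP-> /eqP//]].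
have c'p : proper_coloring e c'.
  move=> x y z exy exz yz; rewrite /c'.
  case: ifP => xy; case: ifP => xz.
  - by rewrite (ab_eq _ _ _ xy xz) eqxx in yz.
  - by rewrite eq_sym (abj x y).
  - exact: (abj x z).
  - apply/eqP=> cyz; have ctop_xy := cprop _ _ _ exy exz yz cyz.
    apply: (M0m exy exz yz).
      by have := ctop [set x; y];
        rewrite mem_edges // exy ctop_xy xy eqxx => /(_ isT) /= <-.
    by have := ctop [set x; z];
      rewrite mem_edges // exz -cyz ctop_xy xz eqxx => /(_ isT) /= <-.
have := M0_small c'd c'p; suff -> : color_class c' d.+1 = M0 by rewrite ltnn.
apply/setP => f; rewrite inE /c'.
have [fE|fE] := boolP (f \in edges e); last first.
  by apply/esym/negbTE; apply: contra fE => /M0E.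
case: ifP => [/eqP->|fab] /=; last by rewrite ctop // fab.
by rewrite (negPf abM0); lia.
Qed.

Lemma shift_shiftable s : shiftable s ->
  [/\ shiftable (shift s), st_tail (shift s) = st_head s & st_head (shift s) !=
    st_tail s].
Proof.
case: s => c a b j k /= [[eab cd abM0] ctop cprop [jd kd jk] [aj bk]].
case: pickP => [w /andP[ebw /eqP cbw]|no_w]; last first.
  case: (@head_not_misses c a b j) => // w ebw.
  by have := no_w w; rewrite ebw /= => ->.
have cab : c [set a; b] = d.+1.
  by apply/eqP; rewrite ctop ?eqxx // mem_edges.
(* The walk cannot turn back: [ab] is uncoloured while [bw] has colour [j <= d]. *)
have wa : w != a.
  by apply/eqP => wa; move: cbw; rewrite wa setUC cab; lia.
have wb : w != b by rewrite eq_sym (edge_neq e_irr ebw).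
have ab : a != b := edge_neq e_irr eab.
have bw_ab : [set b; w] != [set a; b].
  by rewrite eq_set2 (negPf wa) (negPf wb) !andbF.
split=> //=; split.
- split=> [|f fE|]; first done; first by case: ifP => _;
    [lia | case: ifP => _; [lia | exact: cd]].
  have := ctop [set b; w];
    rewrite mem_edges // ebw cbw (negPf bw_ab) => /(_ isT) /= <-; lia.
- move=> f fE; case: ifP => [/eqP->|fbw]; first by rewrite eqxx.
  case: ifP => [/eqP->|fab]; last by rewrite ctop // fab.
  by rewrite (negPf abM0); lia.
- move=> x y z exy exz yz.
  case: ifP => // xybw; case: (boolP ([set x; z] == [set b;
    w])) => [_ //|/negbTE xzbw].
  (* Once [ab] has colour [j], no other edge at its ends has it: [a] missed [j], and the only edge
     of colour [j] at [b] was [bw], now uncoloured. *)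
  have key y1 z1 : e x y1 -> e x z1 -> y1 != z1 -> [set x; z1] == [set b;
    w] = false ->
      [set x; y1] == [set a; b] -> c [set x; z1] = j -> False.
    move=> exy1 exz1 yz1 xz1;
      rewrite eq_set2 => /orP[]/andP[/eqP xE /eqP y1E] cz1.
      by have := aj z1; rewrite -xE cz1 eqxx => /(_ exz1).
    have wz : w != z1 by apply: contraFneq xz1 => ->; rewrite xE.
    rewrite xE in exz1 cz1.
    have := cprop _ _ _ ebw exz1 wz; rewrite cbw cz1 => /(_ erefl) jd1.
    by rewrite jd1 ltnn andbF in jd.
  case: ifP => xyab; case: ifP => xzab.
  + case/negP: yz; have := xzab; rewrite -(eqP xyab) eq_set2 eqxx /=.
    by case/orP=> [/eqP->//|/andP[/eqP-> /eqP->]].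
  + by move/esym=> cxz; case: (key y z).
  + by move=> cxy; case: (key z y) => //; rewrite eq_sym.
  + exact: cprop.
- by split=> //; rewrite eq_sym.
- split=> y ey.
    case: ifP => [_|bybw]; first lia.
    by case: ifP => [_ //|byab]; exact: bk.
  case: ifP => [_|wybw]; first lia.
  case: ifP => [|wyab].
    by rewrite eq_set2 (negPf wa) (negPf wb).
  have yb : y != b by apply: contraFneq wybw => ->; rewrite setUC.
  apply/eqP=> cwy; have := cprop w y b ey; rewrite cwy [[set w; b]]setUC cbw.
  rewrite e_sym => /(_ ebw yb erefl); lia.
Qed.

(** The walk lists the tails of the iterated shifts. Where the moving edge is disjoint from [M0],
    the uncoloured edges again form a matching, so the weak properness of [shiftable] becomes true
    properness. *)
Lemma shift_walk s : shiftable s -> exists p : nat -> T,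
  [/\ forall n, walk e n p, forall n, nonbacktracking n p,
      forall t, [set p t; p t.+1] \notin M0
    & forall t, {in M0, forall f : {set T}, [disjoint [set p t; p t.+1] & f]} ->
      exists c, [/\ in_range e d.+1 c, proper_coloring e c
                  & color_class c d.+1 = [set p t; p t.+1] |: M0]].
Proof.
move=> s_ok; pose st t := iter t shift s; pose p t := st_tail (st t).
have st_ok t : shiftable (st t).
  by elim: t => //= t /shift_shiftable[].
have head_st t : st_head (st t) = p t.+1 by have [_ <-] :=
  shift_shiftable (st_ok t).
exists p; split=> [n t _|n t _|t|t].
- by have := st_ok t; rewrite -head_st /p; case: (st t) => c a b j k [[]].
- by rewrite -head_st eq_sym; have [] := shift_shiftable (st_ok t).
- by have := st_ok t; rewrite -head_st /p; case: (st t) => c a b j k [[]].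
have := st_ok t; rewrite -head_st /p.
case: (st t) => c a b j k /= [[eab cd abM0] ctop cprop _ _] disj.
exists c; split=> // [x y z exy exz yz|]; last first.
  apply/setP=> f; rewrite in_setU1 inE.
  have [fE|fE] := boolP (f \in edges e) => /=; first exact: ctop.
  apply/esym/negbTE; apply: contra fE => /orP[/eqP->|/M0E//].
  by rewrite mem_edges.
apply/eqP => cyz; have cxy := cprop _ _ _ exy exz yz cyz.
have := ctop [set x; z]; have := ctop [set x; y].
rewrite !mem_edges // exy exz -cyz cxy eqxx => /(_ isT)/esym xyM /(_ isT)/esym
  xzM.
have no_x u : [set x; u] \in M0 -> x \in [set a; b] -> False.
  by move=> xuM xab; have /disjointFr/(_ xab) := disj _ xuM; rewrite set21.
case/orP: xyM => [/eqP xyab|xyM]; case/orP: xzM => [/eqP xzab|xzM].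
- case/negP: yz; have/eqP := xyab; rewrite -xzab eq_set2 eqxx /=.
  by case/orP=> [//|/andP[/eqP-> /eqP->]].
- by apply: (no_x z) => //; rewrite -xyab set21.
- by apply: (no_x y) => //; rewrite -xzab set21.
- exact: (M0m exy exz yz).
Qed.

End Shift.

Lemma class_matching c k : proper_coloring e c -> matching (color_class c k).
Proof.
move=> pc x y z exy exz yz; rewrite !inE => /andP[_ /eqP cy] /andP[_ /eqP cz].
by have := pc _ _ _ exy exz yz; rewrite cy cz eqxx.
Qed.

Lemma move_edge c f : in_range e d.+1 c -> proper_coloring e c ->
  (forall c', in_range e d.+1 c' -> proper_coloring e c' ->
    #|color_class c d.+1| <= #|color_class c' d.+1|) ->
  f \in color_class c d.+1 ->
  2 < #|color_class c d.+1| -> 6 * #|color_class c d.+1| - 5 <= girth e ->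
  exists f' c', let M0 := color_class c d.+1 :\ f in
    [/\ in_range e d.+1 c', proper_coloring e c', color_class c' d.+1 = f' |:
      M0,
        f' \notin M0 & \sum_(g in M0) conflict e f' g <= 1].
Proof.
move=> cd pc cmin fc r3 gr; pose M0 := color_class c d.+1 :\ f.
have cardM0 := cardsD1 f (color_class c d.+1); rewrite fc -/M0 in cardM0.
have M0E : {in M0, forall g, g \in edges e}.
  by move=> g /setD1P[_]; rewrite inE => /andP[].
have M0m : matching M0.
  move=> x y z exy exz yz /setD1P[_ xy] /setD1P[_ xz].
  exact: (class_matching pc exy exz yz xy xz).
have M0_small c' : in_range e d.+1 c' -> proper_coloring e c' -> #|M0| <
  #|color_class c' d.+1|.
  by move=> c'd pc'; apply: leq_trans (cmin c' c'd pc'); rewrite cardM0.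
have [fE /eqP cf] : f \in edges e /\ c f == d.+1 by move: fc;
  rewrite inE => /andP[].
have /edgesP[a [b [eab fab]]] := fE.
have [j jd aj] : exists2 k, 0 < k <= d & misses c a k.
  by apply: (color_missed cd fc); rewrite fab set21.
have [k kd bk] : exists2 k, 0 < k <= d & misses c b k.
  by apply: (color_missed cd fc); rewrite fab set22.
have ctop g : g \in edges e -> (c g == d.+1) = (g == [set a; b]) || (g \in M0).
  move=> gE; rewrite in_setD1 [g \in color_class _ _]inE gE -fab /=;
    case: (eqVneq g f) => [->|] //=.
  by rewrite cf eqxx.
have cprop x y z : e x y -> e x z -> y != z ->
    c [set x; y] = c [set x; z] -> c [set x; y] = d.+1.
  by move=> exy exz yz cyz; have := pc _ _ _ exy exz yz; rewrite cyz eqxx.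
have fM0 : [set a; b] \notin M0 by rewrite -fab setD11.
have jk : j != k.
  apply/eqP=> jk; apply: (head_not_misses M0E M0m M0_small eab cd fM0 ctop
    cprop jd aj).
  by rewrite jk.
have [p [wp bp pM0 pc']]
  := shift_walk M0E M0m M0_small
    (s := State c a b j k) (And5 (And3 eab cd fM0) ctop cprop (And3 jd kd jk)
      (conj aj bk)).
(* With [r = #|M0|.+1] the walk length is [n = 4r - 3], which exceeds [4 * #|M0|]. Both [9 <= n] and
   [n + 4 = 4r + 1 <= 6r - 5] amount to [r >= 3]. *)
have [|||t _ [disj le1]] := free_position e_sym e_irr
  (n := 4 * #|M0|.+1 - 3) (wp _) (bp _) _ _ M0E _ (fun t _ => pM0 t); try lia.
have [c' [c'd pc'' c'M]] := pc' t disj.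
by exists [set p t; p t.+1], c'; split=> //.
Qed.

End Shifting.

(** * Optimal colourings whose uncoloured edges rarely conflict *)

Section Optimal.
Variables (T : finType) (e : rel T).
Hypotheses (e_sym : symmetric e) (e_irr : irreflexive e).
Variable d : nat.
Hypothesis e_reg : regular e d.

Definition optimal c := [/\ in_range e d.+1 c, proper_coloring e c
  & forall c', in_range e d.+1 c' -> proper_coloring e c' ->
    #|color_class e c d.+1| <= #|color_class e c' d.+1|].

(** The potential for the descent below. Pairs are ordered and the diagonal is included, so each
    conflict between distinct edges counts twice. *)
Definition conflicts (M : {set {set T}}) :=
  \sum_(f in M) \sum_(g in M) conflict e f g.

Lemma conflictsU1 f (M : {set {set T}}) : f \notin M -> conflicts (f |: M) =
  conflict e f f + 2 * \sum_(g in M) conflict e f g + conflicts M.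
Proof.
move=> fM; rewrite /conflicts big_setU1 //= big_setU1 //= mul2n -addnn !addnA.
rewrite -[RHS]addnA; congr (_ + _); rewrite -big_split /=;
  apply: eq_bigr => g _.
by rewrite big_setU1 //= conflict_sym.
Qed.

(** Descent on [conflicts]: an edge with two or more conflicts is replaced through [move_edge],
    which keeps the size of the class and hence optimality. *)
Lemma optimal_spread c : optimal c ->
  1 < #|color_class e c d.+1| -> 6 * #|color_class e c d.+1| - 5 <= girth e ->
  exists2 c', optimal c' & let M := color_class e c' d.+1 in
    {in M, forall f, \sum_(g in M :\ f) conflict e f g <= 1}.
Proof.
move: {2}(conflicts _) (erefl (conflicts (color_class e c d.+1))) => n.
elim/ltn_ind: n c => n IHn c cn c_opt r2 gr; set M := color_class e c d.+1.
have [/forall_inP|] := boolP [forall f in M, \sum_(g in M :\ f) conflict e f g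
  <= 1].
  by exists c.
case/forall_inPn => f fM; rewrite -ltnNge => f2; have [cd pc cmin] := c_opt.
have cardM := cardsD1 f M; rewrite fM in cardM.
(* Two conflicts of [f] require two further edges of [M], so a class of size 2 is never moved. *)
have r3 : 2 < #|M|.
  suff: 1 < #|M :\ f| by rewrite cardM.
  apply: leq_trans f2 _; rewrite -sum1_card; apply: leq_sum => g _.
  exact: leq_b1.
have [f' [c' [c'd pc' c'M f'M f'1]]] :=
  move_edge e_sym e_irr e_reg cd pc cmin fM r3 gr.
have card' : #|color_class e c' d.+1| = #|M|.
  by rewrite c'M cardsU1 f'M cardM.
apply: (IHn _ _ c' erefl); rewrite ?card' //; last first.
  by split=> // c'' c''d pc''; rewrite card'; exact: cmin.
have fMf : f \notin M :\ f by rewrite setD11.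
have := conflictsU1 fMf; rewrite setD1K // => eqM.
(* The removed edge accounted for at least [2 * 2]; the new one adds at most [2 * 1], plus at most 1
   on the diagonal. *)
rewrite -cn c'M conflictsU1 // -/M eqM; rewrite -/M in f'1;
  have := leq_b1 (conflict e f' f'); lia.
Qed.

(** * Recolouring with odd colours outside [M] and even colours on [M] *)

Section Recolor.
Variable c : {set T} -> nat.
Hypothesis c_opt : optimal c.
Hypothesis girth7 : 6 < girth e.
Let M := color_class e c d.+1.

Definition odd_sum x := \sum_(y | e x y && ([set x; y] \notin M)) (c [set x;
  y]).*2.-1.

Definition sum_odd := \sum_(i <- iota 1 d) i.*2.-1.

Lemma mem_class f : (f \in M) = (f \in edges e) && (c f == d.+1).
Proof. by rewrite inE. Qed.

Lemma class_edge f : f \in M -> f \in edges e.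
Proof. by rewrite mem_class => /andP[]. Qed.

Lemma class_meet f g x : f \in M -> g \in M -> x \in f -> x \in g -> f = g.
Proof.
have [_ pc _] := c_opt.
move=> fM gM xf xg; have [y exy fxy] := edge_mem e_sym (class_edge fM) xf.
have [z exz gxz] := edge_mem e_sym (class_edge gM) xg.
have [yz|yz] := eqVneq y z; first by rewrite fxy gxz yz.
by case: (class_matching pc exy exz yz (k := d.+1)); rewrite -/M -?fxy -?gxz.
Qed.

Lemma color_le x y : e x y -> [set x; y] \notin M -> 0 < c [set x; y] <= d.
Proof.
have [cd _ _] := c_opt; move=> exy.
rewrite mem_class mem_edges // exy /=; have := cd [set x; y].
rewrite mem_edges // => /(_ exy); lia.
Qed.

Let colors x := [seq c [set x; y] | y <- enum [set y | e x y && ([set x;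
  y] \notin M)]].

Lemma mem_colorsP x k : reflect
  (exists y, [/\ e x y, [set x; y] \notin M & k = c [set x;
    y]]) (k \in colors x).
Proof.
apply: (iffP mapP) => [[y]|[y [exy xyM ->]]].
  by rewrite mem_enum inE => /andP[exy xyM] ->; exists y.
by exists y; rewrite // mem_enum inE exy.
Qed.

Lemma odd_sumE x : odd_sum x = \sum_(k <- colors x) k.*2.-1.
Proof.
rewrite /colors big_map big_enum_cond /odd_sum; apply: eq_bigl => y.
by rewrite inE andbT.
Qed.

Lemma uniq_colors x : uniq (colors x).
Proof.
have [_ pc _] := c_opt.
rewrite map_inj_in_uniq ?enum_uniq // => y z; rewrite !mem_enum !inE.
move=> /andP[exy _] /andP[exz _] /eqP cyz; apply/eqP; apply: contraTT cyz.
exact: pc.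
Qed.

Lemma colors_sub x : {subset colors x <= iota 1 d}.
Proof.
move=> k /mem_colorsP[y [exy xyM ->]]; rewrite mem_iota add1n ltnS.
exact: color_le.
Qed.

(** All [d] edges at [x] are coloured, with distinct colours from 1 to [d], so every colour occurs
    exactly once. *)
Lemma odd_sum_unsaturated x : (forall f, f \in M -> x \notin f) -> odd_sum x =
  sum_odd.
Proof.
move=> xM; rewrite odd_sumE; apply: perm_big.
apply: uniq_perm; rewrite ?uniq_colors ?iota_uniq //.
apply: (uniq_min_size (uniq_colors x) (@colors_sub x) _).2.
rewrite size_iota size_map -cardE -(e_reg x) subset_leq_card //.
apply/subsetP => y; rewrite in_set => exy; rewrite in_set exy /=.
by apply: (contraL _ (set21 x y)) => fM; exact: xM.
Qed.

(** The [d - 1] coloured edges at [x] together with one missed colour exhaust 1 to [d]. Removing an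
    odd term is what switches the parity of the sum. *)
Lemma odd_sum_saturated x f : f \in M -> x \in f ->
  exists k, [/\ 0 < k <= d, misses e c x k & odd_sum x + k.*2.-1 = sum_odd].
Proof.
have [cd _ _] := c_opt.
move=> fM xf; have [k kd xk] := color_missed e_sym e_reg cd fM xf.
exists k; split=> //; rewrite odd_sumE addnC.
have [y exy fxy] := edge_mem e_sym (class_edge fM) xf.
have kc : k \notin colors x.
  by apply/negP => /mem_colorsP[z [exz _ kz]]; have := xk z exz;
    rewrite kz eqxx.
transitivity (\sum_(i <- k :: colors x) i.*2.-1); first by rewrite big_cons.
apply: perm_big; have ukc : uniq (k :: colors x) by rewrite /= kc uniq_colors.
apply: uniq_perm; rewrite ?iota_uniq //.
apply: (uniq_min_size ukc _ _).2.
  move=> i; rewrite in_cons => /orP[/eqP->|/colors_sub//].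
  by rewrite mem_iota add1n ltnS.
rewrite size_iota /= size_map -cardE -(e_reg x) (cardsD1 y) inE exy ltnS.
rewrite subset_leq_card //; apply/subsetP => z;
  rewrite in_setD1 in_set => /andP[zy exz].
rewrite in_set exz /=; apply: contra zy => xzM.
have /eqP := class_meet xzM fM (set21 _ _) xf.
rewrite fxy eq_set2 eqxx /=; case/orP=> // /andP[/eqP xy _].
by move: exy; rewrite xy e_irr.
Qed.

Lemma no_short_cycle s : 2 < size s <= 6 -> ucycle e s -> False.
Proof. by case/andP=> s2 s6 /(ucycle_girth s2); lia. Qed.

Definition even_color x := ~~ odd x && (0 < x <= 2 * d).

Lemma even_color_double n : 0 < n <= d -> even_color n.*2.
Proof. by rewrite /even_color odd_double double_gt0 mul2n leq_double. Qed.

(* The constraints on the colours x, y of f, g in M: w is a common neighbour of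
   an endpoint a of f and an endpoint b of g, possibly lying on f or g. *)
Definition distinguishing (f g : {set T}) x y := forall w a b,
  a \in f -> b \in g -> e w a -> e w b ->
  odd_sum a + x + 2 * (if w \in g then y else (c [set w; b]).*2.-1) !=
  odd_sum b + y + 2 * (if w \in f then x else (c [set w; a]).*2.-1).

Lemma distinguishing_sym f g x y : distinguishing f g x y -> distinguishing g f
  y x.
Proof. by move=> fg w a b ag bf wa wb; rewrite eq_sym fg. Qed.

Lemma degree_ge2 w a b : e w a -> e w b -> a != b -> 1 < d.
Proof.
move=> wa wb ab; rewrite -(e_reg w) (cardsD1 a) inE wa (cardsD1 b) !inE eq_sym
  ab.
by rewrite wb.
Qed.

(** By optimality the ends of [f] miss different colours, which for [d = 2] are 1 and 2; the two
    sums thus lose 1 and 3 from 4. This supplies the [d = 2] hypothesis of [avoid_two]. *)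
Lemma odd_sum_edge f a b : d = 2 -> f \in M -> a \in f -> b \in f -> a != b ->
  odd_sum a + odd_sum b = 4.
Proof.
have [cd pc cmin] := c_opt.
move=> d2 fM af bf ab; have fab : f = [set a; b].
  have [z eaz faz] := edge_mem e_sym (class_edge fM) af.
  by move: bf; rewrite faz in_set2 eq_sym (negPf ab) => /eqP->.
have [j [jd aj aS]] := odd_sum_saturated fM af.
have [k [kd bk bS]] := odd_sum_saturated fM bf.
have jk : j != k.
  apply/eqP => jk; pose M0 := M :\ f.
  apply: (@head_not_misses _ e e_sym d M0 _ _ _ c a b j) => //.
  - by move=> g /setD1P[_ /class_edge].
  - move=> x y z exy exz yz /setD1P[_ xyM] /setD1P[_ xzM].
    exact: (class_matching pc exy exz yz xyM xzM).
  - move=> c' c'd pc'; apply: leq_trans (cmin c' c'd pc').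
    by rewrite -/M (cardsD1 f M) fM.
  - by have := class_edge fM; rewrite fab mem_edges.
  - by rewrite -fab setD11.
  - move=> g gE; rewrite -fab in_setD1 mem_class gE /=.
    case: (eqVneq g f) => [->|] //=.
    by move: fM; rewrite mem_class => /andP[].
  - move=> x y z exy exz yz cyz.
    by have := pc _ _ _ exy exz yz; rewrite cyz eqxx.
  - by rewrite jk.
have S4 : sum_odd = 4 by rewrite /sum_odd d2 /= !big_cons big_nil.
move: aS bS; rewrite S4; lia.
Qed.

(** The girth limits the triples [w, a, b] to be handled. If an edge [uu'] joins [f] and [g], there
    are two, centred at [u] and [u']; otherwise there is at most one, centred outside both edges. *)
Lemma distinguishing_color f g y : f \in M -> g \in M -> f != g -> even_color y
  ->
  exists2 x, even_color x & distinguishing f g x y.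
Proof.
move=> fM gM fg y_even.
have disj x : x \in f -> x \in g -> False.
  by move=> xf xg; rewrite (class_meet fM gM xf xg) eqxx in fg.
have fE := class_edge fM; have gE := class_edge gM.
have [/exists_inP[u uf /exists_inP[u' u'g uu']]|no_edge] :=
    boolP [exists u in f, exists u' in g, e u u'].
  have [v uv fuv] := edge_mem e_sym fE uf.
  have [v' uv' guv] := edge_mem e_sym gE u'g.
  have vf : v \in f by rewrite fuv set22.
  have v'g : v' \in g by rewrite guv set22.
  have uNg : u \notin g by apply/negP => /(disj u uf).
  have vNg : v \notin g by apply/negP => /(disj v vf).
  have u'Nf : u' \notin f by apply/negP => /disj; exact.
  have neqs : [/\ u != u', u != v', v != u' & v != v'].
    by split; [apply: contraNneq uNg => -> | apply: contraNneq uNg => ->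
             | apply: contraNneq vNg => -> | apply: contraNneq vNg => ->].
  have [nuu' nuv' nvu' nvv'] := neqs.
  have nuv := edge_neq e_irr uv; have nuv1 := edge_neq e_irr uv'.
  (* Any further common neighbour would close a cycle of length 3, 4 or 5 with [uu']. *)
  have triple w a b : a \in f -> b \in g -> e w a -> e w b ->
      [/\ w = u, a = v & b = u'] \/ [/\ w = u', a = u & b = v'].
    move=> af bg wa wb; have nwa := edge_neq e_irr wa;
      have nwb := edge_neq e_irr wb.
    move: af bg; rewrite fuv guv !in_set2.
    case/orP=> /eqP aE; case/orP=> /eqP bE; rewrite aE bE in wa wb nwa nwb *.
    - case: (@no_short_cycle [:: w; u; u']) => //.
      by rewrite /ucycle /= wa uu' e_sym wb !inE negb_or nwa nwb nuu'.
    - right; split=> //; apply/eqP; apply: contraT => nwu'.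
      case: (@no_short_cycle [:: w; u; u'; v']) => //.
      by rewrite /ucycle /= wa uu' uv' e_sym wb !inE !negb_or nwa nwb nwu' nuu'
        nuv' nuv1.
    - left; split=> //; apply/eqP; apply: contraT => nwu.
      case: (@no_short_cycle [:: w; v; u; u']) => //.
      rewrite /ucycle /= wa uu' [e v u]e_sym uv e_sym wb !inE !negb_or nwa nwb
        nwu.
      by rewrite nuu' nvu' eq_sym nuv.
    - have [wu|nwu] := eqVneq w u.
        case: (@no_short_cycle [:: u; u'; v']) => //.
        by rewrite /ucycle /= uu' uv' e_sym -wu wb !inE negb_or wu nuu' nuv'
          nuv1.
      have [wu'|nwu'] := eqVneq w u'.
        case: (@no_short_cycle [:: u'; v; u]) => //.
        rewrite /ucycle /= -{1}wu' wa uu' [e v u]e_sym uv !inE negb_or.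
        by rewrite [_ == v]eq_sym nvu' [_ == u]eq_sym nuu' eq_sym nuv.
      case: (@no_short_cycle [:: w; v; u; u'; v']) => //.
      rewrite /ucycle /= wa uu' uv' [e v u]e_sym uv e_sym wb !inE !negb_or nwa
        nwb nwu nwu'.
      by rewrite nuu' nuv' nvu' nvv' nuv1 eq_sym nuv.
  pose k := (c [set u; u']).*2.-1.
  have d_gt1 : 1 < d by apply: (degree_ge2 uv uu').
  have [n nd /andP[ok1 ok2]] : exists2 n, 0 < n <= d &
      (odd_sum v + n.*2 + 2 * k != odd_sum u' + y + 2 * n.*2) &&
      (odd_sum u + n.*2 + 2 * y != odd_sum v' + y + 2 * k).
    apply: avoid_two => // d2.
    by rewrite (odd_sum_edge d2 fM uf vf nuv) (odd_sum_edge d2 gM u'g v'g nuv1).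
  exists n.*2; first exact: even_color_double.
  move=> w a b af bg wa wb; case: (triple w a b af bg wa wb) => -[-> -> ->].
    by rewrite (negPf uNg) uf.
  by rewrite u'g (negPf u'Nf) [[set u'; u]]setUC.
have no_edgeP a b : a \in f -> b \in g -> e a b = false.
  move=> af bg; apply: contraNF no_edge => eab.
  by apply/exists_inP; exists a => //; apply/exists_inP; exists b.
have [/conflictP[w [a [b [af bg wa wb]]]]|no_conf] := boolP (conflict e f g);
  last first.
  (* Without a conflict the requirement is vacuous, and the least even colour serves. *)
  exists 2; last first.
    move=> w a b af bg wa wb; case/negP: no_conf.
    by apply/conflictP; exists w, a, b.
  have /edgesP[x [z [exz _]]] := fE.
  apply: (@even_color_double 1); rewrite -(e_reg x).
  by rewrite (cardsD1 z) inE exz.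
have nab : a != b by apply/eqP => ab; apply: (disj a) => //; rewrite ab.
(* A common neighbour lying on [f] or [g] would itself be an end of an edge joining the two. *)
have outside w1 a1 b1 : a1 \in f -> b1 \in g -> e w1 a1 -> e w1 b1 ->
    (w1 \notin f) * (w1 \notin g).
  move=> a1f b1g wa1 wb1; split; apply/negP => w1in.
    by rewrite (no_edgeP w1 b1) in wb1.
  by rewrite e_sym (no_edgeP a1 w1) in wa1.
have other a1 a2 h : h \in M -> a1 \in h -> a2 \in h -> a1 != a2 -> e a1 a2.
  move=> hM a1h a2h na; have [z ez hz] := edge_mem e_sym (class_edge hM) a1h.
  by move: a2h; rewrite hz in_set2 eq_sym (negPf na) => /eqP->.
(* A second triple would close a cycle of length 3 to 6; length 6 occurs when both ends and the
   centre change. *)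
have triple w1 a1 b1 : a1 \in f -> b1 \in g -> e w1 a1 -> e w1 b1 ->
    [/\ w1 = w, a1 = a & b1 = b].
  move=> a1f b1g wa1 wb1.
  have [wNf wNg] := outside w a b af bg wa wb.
  have [w1Nf w1Ng] := outside w1 a1 b1 a1f b1g wa1 wb1.
  have neq_out u (h : {set T}) z : u \notin h -> z \in h -> u != z.
    by move=> uNh zh; apply: contraNneq uNh => ->.
  have nfg u z : u \in f -> z \in g -> u != z.
    by move=> uf zg; apply/eqP => uz; apply: (disj u) => //; rewrite uz.
  have nwa := neq_out _ _ _ wNf af; have nwb := neq_out _ _ _ wNg bg.
  have nwa1 := neq_out _ _ _ wNf a1f; have nwb1 := neq_out _ _ _ wNg b1g.
  have nw1a := neq_out _ _ _ w1Nf af; have nw1b := neq_out _ _ _ w1Ng bg.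
  have nw1a1 := neq_out _ _ _ w1Nf a1f; have nw1b1 := neq_out _ _ _ w1Ng b1g.
  have na1b := nfg _ _ a1f bg; have nab1 := nfg _ _ af b1g.
  have na1b1 := nfg _ _ a1f b1g.
  have [aa1|naa1] := eqVneq a1 a; have [bb1|nbb1] := eqVneq b1 b.
  - split=> //; apply/eqP; apply: contraT => nww1.
    rewrite aa1 bb1 in wa1 wb1.
    case: (@no_short_cycle [:: w1; a; w; b]) => //.
    rewrite /ucycle /= wa1 e_sym wa wb e_sym wb1 !inE !negb_or nw1a nww1 nw1b.
    by rewrite [a == w]eq_sym nwa nab nwb.
  - have ebb1 : e b b1 by apply: (other _ _ _ gM bg b1g); rewrite eq_sym.
    rewrite aa1 in wa1; have [ww1|nww1] := eqVneq w1 w.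
      rewrite ww1 in wb1; case: (@no_short_cycle [:: w; b; b1]) => //.
      by rewrite /ucycle /= wb ebb1 e_sym wb1 !inE negb_or nwb nwb1 eq_sym nbb1.
    case: (@no_short_cycle [:: w1; a; w; b; b1]) => //.
    rewrite /ucycle /= wa1 [e a w]e_sym wa wb ebb1 e_sym wb1 !inE !negb_or.
    by rewrite nw1a nww1 nw1b nw1b1 [a == w]eq_sym nwa nab nab1 nwb nwb1 eq_sym
      nbb1.
  - have eaa1 : e a a1 by apply: (other _ _ _ fM af a1f); rewrite eq_sym.
    rewrite bb1 in wb1; have [ww1|nww1] := eqVneq w1 w.
      rewrite ww1 in wa1; case: (@no_short_cycle [:: w; a; a1]) => //.
      by rewrite /ucycle /= wa eaa1 e_sym wa1 !inE negb_or nwa nwa1 eq_sym naa1.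
    case: (@no_short_cycle [:: w1; a1; a; w; b]) => //.
    rewrite /ucycle /= wa1 [e a w]e_sym wa wb [e a1 a]e_sym eaa1 e_sym wb1 !inE
      !negb_or.
    by rewrite nw1a nww1 nw1b nw1a1 [a == w]eq_sym nwa nab na1b nwb naa1 eq_sym
      nwa1.
  - have ebb1 : e b b1 by apply: (other _ _ _ gM bg b1g); rewrite eq_sym.
    have eaa1 : e a a1 by apply: (other _ _ _ fM af a1f); rewrite eq_sym.
    have [ww1|nww1] := eqVneq w1 w.
      rewrite ww1 in wa1; case: (@no_short_cycle [:: w; a; a1]) => //.
      by rewrite /ucycle /= wa eaa1 e_sym wa1 !inE negb_or nwa nwa1 eq_sym naa1.
    case: (@no_short_cycle [:: w1; a1; a; w; b; b1]) => //.
    rewrite /ucycle /= wa1 [e a w]e_sym wa wb [e a1 a]e_sym eaa1 ebb1 e_sym wb1.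
    rewrite !inE !negb_or nw1a nww1 nw1b nw1b1 nw1a1 [a == w]eq_sym nwa nab
      nab1 na1b na1b1.
    by rewrite nwb nwb1 naa1 [a1 == w]eq_sym nwa1 eq_sym nbb1.
have d_gt1 : 1 < d := degree_ge2 wa wb nab.
have [n /andP[n_gt0 n_le2] n_ok] := avoid_one (odd_sum a + 2 * (c [set w;
  b]).*2.-1)
  (odd_sum b + y + 2 * (c [set w; a]).*2.-1).
exists n.*2; first by rewrite even_color_double // n_gt0 (leq_trans n_le2).
move=> w1 a1 b1 a1f b1g wa1 wb1.
have [w1Nf w1Ng] := outside w1 a1 b1 a1f b1g wa1 wb1.
rewrite (negPf w1Nf) (negPf w1Ng).
by have [-> -> ->] := triple w1 a1 b1 a1f b1g wa1 wb1; rewrite addnAC.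
Qed.

(** The even colours [X] come from [matching_choice], applied to conflicting pairs of [M]. For edges
    [xy] and [xz] the cases depend on which of [y], [z] are covered by [M]. *)
Lemma optimal_nbr_sum_colorable : 0 < d ->
  {in M, forall f, \sum_(g in M :\ f) conflict e f g <= 1} ->
  nbr_sum_colorable e (2 * d).
Proof.
have [cd pc _] := c_opt.
move=> d_gt0 M1; have [X [X_even X_dist]] := matching_choice (conflict_sym e)
  (ex_intro even_color 2 (@even_color_double 1 d_gt0)) M1 distinguishing_sym
    distinguishing_color.
pose h f := if f \in M then X f else (c f).*2.-1.
have h_saturated f x y : f \in M -> x \in f -> e y x ->
    h [set y; x] = if y \in f then X f else (c [set y; x]).*2.-1.
  move=> fM xf eyx; rewrite /h; case: ifP => [yxM|yxM].
    have <- := class_meet yxM fM (set22 y x) xf.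
    by rewrite set21.
  case: ifP => // yf; suff : [set y; x] \in M by rewrite yxM.
  have [z exz fxz] := edge_mem e_sym (class_edge fM) xf.
  move: yf; rewrite fxz in_set2 (negPf (edge_neq e_irr eyx)) /= => /eqP->.
  by rewrite setUC -fxz.
have sumE x : vertex_sum e h x =
    odd_sum x + \sum_(y | e x y && ([set x; y] \in M)) X [set x; y].
  rewrite /vertex_sum (bigID (fun y => [set x; y] \in M)) /= addnC;
    congr (_ + _).
    by apply: eq_bigr => y /andP[_ /negPf xyM]; rewrite /h xyM.
  by apply: eq_bigr => y /andP[_ xyM]; rewrite /h xyM.
have sum_unsat x : (forall f, f \in M -> x \notin f) -> vertex_sum e h x =
  sum_odd.
  move=> xM; rewrite sumE odd_sum_unsaturated // big1 ?addn0 // => y /andP[_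
    /xM].
  by rewrite set21.
have sum_sat f x : f \in M -> x \in f -> vertex_sum e h x = odd_sum x + X f.
  move=> fM xf; have [y exy fxy] := edge_mem e_sym (class_edge fM) xf.
  rewrite sumE (bigD1 y) /=; last by rewrite exy -fxy.
  rewrite -fxy big1 ?addn0 // => z /andP[/andP[exz xzM] zy].
  have /eqP := class_meet xzM fM (set21 _ _) xf.
  rewrite fxy eq_set2 (negPf zy) andbF /= => /andP[/eqP xy _].
  by rewrite xy e_irr in exy.
apply: (@proper_nbr_sum_colorable _ _ e_sym e_irr _ h).
- move=> f fE; rewrite /h; case: ifP => [fM|fM];
    first by case/andP: (X_even f fM).
  have /edgesP[x [y [exy fxy]]] := fE; rewrite fxy in fM *.
  by have := color_le exy (negbT fM); lia.
- move=> x y z exy exz yz; rewrite /h.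
  case: ifP => [xyM|/negbT xyM]; case: ifP => [xzM|/negbT xzM].
  + by case: (class_matching pc exy exz yz xyM xzM).
  + have := color_le exz xzM; have := X_even _ xyM; rewrite /even_color; lia.
  + have := color_le exy xyM; have := X_even _ xzM; rewrite /even_color; lia.
  + have := color_le exy xyM; have := color_le exz xzM;
      have := pc _ _ _ exy exz yz.
    lia.
move=> x y z exy exz yz.
have satP u : {f | f \in M & u \in f} + (forall f, f \in M -> u \notin f).
  have [f /andP[fM uf]|noM] := pickP (fun f => (f \in M) && (u \in f)).
    by left; exists f.
  by right=> f fM; apply/negP => uf; have := noM f; rewrite fM uf.
have [[f fM yf]|yM] := satP y; have [[g gM zg]|zM] := satP z.
(* If [y] and [z] lie on the same edge of [M], then [xyz] is a triangle. Otherwise [x] witnesses a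
   conflict, and the choice of [X] applies. *)
- have [fg|fg] := eqVneq f g.
    have [y' eyy' fyy'] := edge_mem e_sym (class_edge fM) yf.
    have eyz : e y z.
      by move: zg; rewrite -fg fyy' in_set2 eq_sym (negPf yz) => /eqP->.
    case: (@no_short_cycle [:: x; y; z]) => //.
    by rewrite /ucycle /= exy eyz e_sym exz !inE negb_or yz !(edge_neq e_irr).
  rewrite (sum_sat f y) // (sum_sat g z) // (h_saturated f y) // (h_saturated g
    z) //.
  apply: X_dist => //; apply/conflictP.
  by exists x, y, z.
(* Exactly one of [y] and [z] is covered, so the vertex sums differ in parity, while the correction
   terms are even. *)
- rewrite (sum_sat f y) // (sum_unsat z) //.
  have [k [kd _ kS]] := odd_sum_saturated fM yf.
  have := X_even _ fM; rewrite /even_color -kS; lia.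
- rewrite (sum_sat g z) // (sum_unsat y) //.
  have [k [kd _ kS]] := odd_sum_saturated gM zg.
  have := X_even _ gM; rewrite /even_color -kS; lia.
(* Equal vertex sums cancel, and the two edges have distinct odd colours. *)
- rewrite !sum_unsat // /h.
  have xyM : [set x; y] \notin M by apply: (contraL _ (set22 x y)) => fM;
    exact: yM.
  have xzM : [set x; z] \notin M by apply: (contraL _ (set22 x z)) => fM;
    exact: zM.
  rewrite (negPf xyM) (negPf xzM).
  have := color_le exy xyM; have := color_le exz xzM;
    have := pc _ _ _ exy exz yz.
  lia.
Qed.

End Recolor.
End Optimal.

(** * From resistance and girth to the bound on [eta_p] *)

Theorem theorem2p12 (T : finType) (e : rel T) (d : nat)
  (e_sym : symmetric e) (e_irr : irreflexive e)
  (e_reg : regular e d)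
  (e_class2 : chromatic_index e = d.+1)
  (r_ge2 : 2 <= resistance e d)
  (girth_ge : 6 * resistance e d - 5 <= girth e) :
  eta_p e <= 2 * d /\ 2 * d = 2 * chromatic_index e - 2.
Proof.
split; last by rewrite e_class2; lia.
(* Class 2 yields a proper colouring with [d.+1] colours, so the minimum defining [resistance] is
   attained by a colouring. *)
have [c0 pc0] : exists c : {ffun {set T} -> 'I_d.+2}, proper_edge_coloring e c.
  move: e_class2; rewrite /chromatic_index;
    case: ex_minnP => k /existsP[c pc] _ kd.
  by move: c pc; rewrite kd => c; exists c.
pose size_top (c : {ffun {set T} -> 'I_d.+2}) :=
  #|[set f in edges e | c f == d.+1 :> nat]|.
have top_le : size_top c0 <= #|edges e|.
  by apply/subset_leq_card/subsetP => f; rewrite in_set => /andP[].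
have [c pc rc] := bigminn_attained (F := size_top) pc0 top_le.
rewrite -/(resistance e d) in rc.
have [cd pc'] := proper_edge_coloring_proper e_sym e_irr pc.
have c_opt : optimal e d (fun f => c f).
  split=> // c' c'd pc''; rewrite -[X in X <= _]rc.
  have pcf := proper_color_ffun e_sym c'd pc''.
  apply: leq_trans (bigminn_leq size_top #|edges e| pcf) _.
  apply/subset_leq_card/subsetP => f; rewrite inE => /andP[fE].
  by rewrite (color_ffunE c'd) // => cf; rewrite in_set fE.
have rE : resistance e d = #|color_class e (fun f => c f) d.+1| by [].
rewrite rE in r_ge2 girth_ge.
have [c' c'_opt spread] :=
  optimal_spread e_sym e_irr e_reg c_opt r_ge2 girth_ge.
have d_gt0 : 0 < d.
  have /card_gt0P[f] : 0 < #|color_class e (fun f => c f) d.+1| by lia.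
  rewrite inE => /andP[/edgesP[x [y [exy _]]] _].
  by rewrite -(e_reg x) (cardsD1 y) inE exy.
(* From [r >= 2] it follows that [6 * r - 5 >= 7]. *)
have g7 : 6 < girth e by lia.
have := optimal_nbr_sum_colorable e_sym e_irr e_reg c'_opt g7 d_gt0 spread.
by rewrite /eta_p; case: ex_minnP => k _ + H => /(_ _ H).
Qed.
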